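(* For every fixed integer $k\ge0$, $$\mathbb{E}[X_k(n)]=c_k\,n\,\big(1+O(n^{-1})\big),\qquad c_k:=2\int_0^{1/2}\sqrt{1-2\xi}\,B_k'(\xi)\,d\xi .$$
   Context: A plane increasing tree on $[n]$ is a rooted tree with vertex set $[n]$ in which every non-root vertex has a larger label than its parent (the root is $1$) and the children of each vertex are linearly ordered; there are $(2n-3)!!$ such trees. Let $T_n$ be uniformly random among them. The rank of a vertex $v$ is the number of edges of a shortest path from $v$ down to a leaf descendant of $v$. $X_k(n)$ is the number of vertices of rank $k$ in $T_n$. Let $b_k(n)$ be the number of plane increasing trees on $[n]$ whose root has rank $k$, and $B_k(z)=\sum_{n\ge1}b_k(n)z^n/n!$ (a power series converging for $|z|<1/2$). *)

(* Defs.v *)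
From HB Require Import structures.
From mathcomp Require Import all_boot all_order all_algebra finmap.
From mathcomp Require Import all_classical all_reals all_analysis.
Import Order.TTheory GRing.Theory Num.Theory.
Import numFieldNormedType.Exports.

Set Implicit Arguments.
Unset Strict Implicit.
Unset Printing Implicit Defensive.

Local Open Scope classical_set_scope.
Local Open Scope fset_scope.
Local Open Scope ring_scope.

(* Plane rooted trees with vertices labelled by natural numbers: a vertex is
   given by its label and the linearly ordered list of the subtrees rooted at
   its children. *)
Unset Elimination Schemes.
Inductive ptree : Type := PNode of nat & seq ptree.
Set Elimination Schemes.

Definition ptree_ind (P : ptree -> Prop)
    (IH : forall a ts, foldr (fun t => and (P t)) True ts -> P (PNode a ts)) :=
  fix loop t : P t :=
    let: PNode a ts := t in
    let fix iter_conj s : foldr (fun t => and (P t)) True s :=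
      if s is t :: s' then conj (loop t) (iter_conj s') else Logic.I in
    IH a ts (iter_conj ts).

Fixpoint ptree_to_gen (t : ptree) : GenTree.tree nat :=
  let: PNode a ts := t in GenTree.Node a (map ptree_to_gen ts).

Fixpoint ptree_of_gen (g : GenTree.tree nat) : ptree :=
  match g with
  | GenTree.Leaf a => PNode a [::]
  | GenTree.Node a gs => PNode a (map ptree_of_gen gs)
  end.

Lemma ptree_to_genK : cancel ptree_to_gen ptree_of_gen.
Proof.
elim=> a ts IH /=; congr PNode.
by elim: ts IH => //= t ts IHts [-> /IHts ->].
Qed.

HB.instance Definition _ := Countable.copy ptree (can_type ptree_to_genK).

Definition label (t : ptree) : nat := let: PNode a _ := t in a.
Definition children (t : ptree) : seq ptree := let: PNode _ ts := t in ts.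

(* One entry per vertex v of t: the subtree of t consisting of v and its
   descendants. *)
Fixpoint vertices (t : ptree) : seq ptree :=
  t :: flatten (map vertices (let: PNode _ ts := t in ts)).

Definition increasing (t : ptree) : bool :=
  all (fun v => all (fun c => label v < label c)%N (children v)) (vertices t).

Definition plane_increasing (n : nat) (t : ptree) : bool :=
  perm_eq (map label (vertices t)) (iota 1 n) && increasing t.

Definition PIT (n : nat) : {fset ptree} :=
  fset_set [set t : ptree | plane_increasing n t].

(* There is a path with d edges from the root of t down to a leaf. *)
Fixpoint leaf_at_depth (d : nat) (t : ptree) : bool :=
  match d with
  | 0%N => nilp (children t)
  | d'.+1 => has (leaf_at_depth d') (children t)
  end.

Lemma ex_leaf_at_depth (t : ptree) : exists d, leaf_at_depth d t.
Proof.
elim: t => a [|t ts] /=; first by exists 0%N.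
by case=> [[d td] _]; exists d.+1; rewrite /= td.
Qed.

Definition rank (t : ptree) : nat := ex_minn (ex_leaf_at_depth t).

Definition num_rank (k : nat) (t : ptree) : nat :=
  count (fun v => rank v == k) (vertices t).

(* The expectation of f(T_n), with T_n uniformly distributed on PIT n. *)
Definition PIT_expectation (R : realType) (n : nat) (f : ptree -> R) : R :=
  (\sum_(t <- PIT n) f t) / #|` PIT n|%:R.

Definition num_root_rank (k n : nat) : nat :=
  #|` [fset t in PIT n | rank t == k]|.

(* The term of index 0 of this power series vanishes, as PIT 0 is empty. *)
Definition root_rank_egf (R : realType) (k : nat) (z : R) : R :=
  limn (pseries (fun n => (num_root_rank k n)%:R / n`!%:R) z).

Definition rank_constant (R : realType) (k : nat) : R :=
  2 * \int[@lebesgue_measure R]_(x in `[0, 2^-1])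
        (Num.sqrt (1 - 2 * x) * derive1 (@root_rank_egf R k : R -> R) x).

(* Main.v *)
Require Import Defs.
From mathcomp Require Import all_boot all_order all_algebra finmap.
From mathcomp Require Import all_classical all_reals all_analysis.
From mathcomp Require Import measurable_realfun ring lra.
Import Order.TTheory GRing.Theory Num.Theory.
Import numFieldNormedType.Exports.
Local Open Scope classical_set_scope.
Local Open Scope ring_scope.

(* Every plane increasing tree on [n+1] arises exactly once by inserting the leaf
   n+1 at one of the 2n-1 positions of a tree on [n].  For a statistic f that ignores
   labels, let p_m be the mean of f over the trees on [m] and e_n the mean, over the
   trees T on [n], of the sum of f over the subtrees rooted at the vertices of T.
   Inserting a leaf changes a given subtree of size m in 2m-1 of the 2n-1 cases, and
   induction on n, for all f simultaneously, gives the exact formula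
     e_n = p_n + (2n-1) \sum_(1 <= m < n) p_m / ((2m-1)(2m+1)).
   Let f be the indicator of rank k.  As 0 <= p_m <= 1, the series converges with
   tail O(1/n), hence e_n = 2 S n + O(1), where S > 0 is its sum.
   Finally 2 S = c_k: expand B_k' as a power series, integrate term by term, and use
     \int_0^(1/2) sqrt (1 - 2x) x^(m-1) dx = (m-1)! / (1 * 3 * ... * (2m+1)). *)

(** * Simultaneous induction on trees and forests *)

(** Recursion on trees passes through lists of children, so a claim on trees is proved below
    together with a companion claim on forests. *)
Lemma ptree_forest_ind (P : ptree -> Prop) (Q : seq ptree -> Prop) :
  (forall a ts, Q ts -> P (PNode a ts)) -> Q [::] ->
  (forall t ts, P t -> Q ts -> Q (t :: ts)) ->
  (forall t, P t) /\ (forall ts, Q ts).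
Proof.
move=> PQ Q0 QS.
have Pt t : P t.
  by elim: t => a ts IH; apply: PQ; elim: ts IH => //= t ts IHts [Pt /IHts]; apply: QS.
by split=> //; elim=> // t ts; apply: QS.
Qed.

Definition forest_vertices (ts : seq ptree) : seq ptree :=
  flatten (map vertices ts).

Definition leaf (a : nat) : ptree := PNode a [::].

Lemma vertices_node a ts :
  vertices (PNode a ts) = PNode a ts :: forest_vertices ts.
Proof. by []. Qed.

Lemma forest_vertices_cons t ts :
  forest_vertices (t :: ts) = vertices t ++ forest_vertices ts.
Proof. by []. Qed.

Lemma root_vertices t : t \in vertices t.
Proof. by case: t => a ts; rewrite vertices_node mem_head. Qed.

Lemma child_vertices t v c :
  v \in vertices t -> c \in children v -> c \in vertices t.
Proof.
suff [h _] : (forall t, forall v c, v \in vertices t -> c \in children v -> c \in vertices t) /\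
    (forall ts, forall v c, v \in forest_vertices ts -> c \in children v ->
     c \in forest_vertices ts)
  by exact: h.
apply: ptree_forest_ind => {t v c} [a ts IH v c||t ts IHt IHts v c] //; last first.
  rewrite forest_vertices_cons !mem_cat => /orP[vt|vts] cv.
    by rewrite (IHt v c vt cv).
  by rewrite (IHts v c vts cv) orbT.
rewrite vertices_node !inE => /orP[/eqP -> /= cts|vts cv]; last first.
  by rewrite (IH v c vts cv) orbT.
apply/orP; right; apply/flattenP; exists (vertices c); first exact: map_f.
exact: root_vertices.
Qed.

Lemma increasing_node b ts : increasing (PNode b ts) =
  all (fun c => b < label c)%N ts && all increasing ts.
Proof.
rewrite /increasing vertices_node /=; congr andb.
by elim: ts => // t ts IH; rewrite /= all_cat IH.
Qed.

(** * Insertion and deletion of a leaf *)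

(** The recursion on trees enters as the parameter [I], which keeps the nested recursion structural.
    Every gap of the list is a position; the empty list accounts for the last gap. *)
Definition forest_insertions (I : ptree -> seq ptree) (x : ptree) :=
  fix loop ts : seq (seq ptree) :=
    if ts is t :: ts' then
      (x :: t :: ts') :: [seq t' :: ts' | t' <- I t] ++ [seq t :: us | us <- loop ts']
    else [:: [:: x]].

Fixpoint insertions (x t : ptree) : seq ptree :=
  let: PNode b ts := t in
  [seq PNode b us | us <- forest_insertions (insertions x) x ts].

Notation finsertions x := (forest_insertions (insertions x) x).

Lemma insertions_node x b ts :
  insertions x (PNode b ts) = [seq PNode b us | us <- finsertions x ts].
Proof. by []. Qed.

Lemma finsertions_cons x t ts : finsertions x (t :: ts) =
  (x :: t :: ts) ::
    [seq t' :: ts | t' <- insertions x t] ++ [seq t :: us | us <- finsertions x ts].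
Proof. by []. Qed.

(** A subtree with root label [a] is dropped whole, so this removes a single vertex only when that
    vertex is a leaf. *)
Definition forest_deletion (D : ptree -> ptree) (a : nat) :=
  fix loop ts : seq ptree :=
    if ts is t :: ts' then
      if label t == a then loop ts' else D t :: loop ts'
    else [::].

Fixpoint deletion (a : nat) (t : ptree) : ptree :=
  let: PNode b ts := t in PNode b (forest_deletion (deletion a) a ts).

Notation fdeletion a := (forest_deletion (deletion a) a).

Lemma label_insertions x t t' : t' \in insertions x t -> label t' = label t.
Proof. by case: t => b ts /mapP[us _ ->]. Qed.

Lemma label_deletion a t : label (deletion a t) = label t.
Proof. by case: t. Qed.

(** A vertex with d children offers d + 1 gaps; summing over a tree with N vertices gives N + (N -
    1). A forest counts as the children of one extra root. *)
Lemma size_insertions_both x :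
  (forall t, (size (insertions x t)).+1 = (2 * size (vertices t))%N) /\
  (forall ts, size (finsertions x ts) = (2 * size (forest_vertices ts)).+1).
Proof.
apply: ptree_forest_ind => [b ts IH||t ts IHt IHts] //.
  by rewrite insertions_node size_map IH vertices_node /= mulnS.
rewrite finsertions_cons forest_vertices_cons /= !size_cat !size_map IHts.
by rewrite mulnDr -IHt !addSn addnS.
Qed.

Lemma size_insertions x t :
  (size (insertions x t)).+1 = (2 * size (vertices t))%N.
Proof. exact: (size_insertions_both x).1. Qed.

Lemma size_finsertions x ts :
  size (finsertions x ts) = (2 * size (forest_vertices ts)).+1.
Proof. exact: (size_insertions_both x).2. Qed.

Lemma labels_insertions a t t' : t' \in insertions (leaf a) t ->
  perm_eq (map label (vertices t')) (a :: map label (vertices t)).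
Proof.
suff [h _] : (forall t, forall t', t' \in insertions (leaf a) t ->
     perm_eq (map label (vertices t')) (a :: map label (vertices t))) /\
    (forall ts, forall us, us \in finsertions (leaf a) ts ->
     perm_eq (map label (forest_vertices us)) (a :: map label (forest_vertices ts)))
  by exact: h.
apply: ptree_forest_ind => {t t'} [b ts IH _ /mapP[us /IH uss ->]|us|t ts IHt IHts us].
- rewrite !vertices_node /=.
  rewrite -[X in perm_eq _ X]/([:: a] ++ [:: b] ++ map label (forest_vertices ts)).
  by rewrite perm_sym perm_catCA /= perm_cons perm_sym.
- by rewrite inE => /eqP ->.
- rewrite finsertions_cons inE mem_cat => /or3P[/eqP ->|/mapP[t' /IHt pt ->]|].
  + by rewrite forest_vertices_cons.
  + rewrite !forest_vertices_cons !map_cat -cat_cons perm_cat2r; exact: pt.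
  + move=> /mapP[us' /IHts pus ->].
    rewrite !forest_vertices_cons !map_cat -cat1s perm_sym perm_catCA perm_cat2l.
    by rewrite perm_sym.
Qed.

(** A leaf with a label above all others may hang from any vertex. The forest claim also carries the
    lower bounds on root labels that the parent imposes. *)
Lemma increasing_insertions a t t' : t' \in insertions (leaf a) t ->
  increasing t -> all (fun b => b < a)%N (map label (vertices t)) -> increasing t'.
Proof.
suff [h _] : (forall t, forall t', t' \in insertions (leaf a) t -> increasing t ->
     all (fun b => b < a)%N (map label (vertices t)) -> increasing t') /\
    (forall ts, forall us, us \in finsertions (leaf a) ts -> all increasing ts ->
     all (fun b => b < a)%N (map label (forest_vertices ts)) ->
     all increasing us /\ forall b, (b < a)%N -> all (fun c => b < label c)%N ts ->
       all (fun c => b < label c)%N us)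
  by exact: h.
apply: ptree_forest_ind => {t t'} [b ts IH _ /mapP[us uss ->]|us|t ts IHt IHts us].
- rewrite !increasing_node vertices_node /= => /andP[bts its] /andP[ba la].
  by have [-> ->] := IH _ uss its la.
- by rewrite inE => /eqP -> _ _; split=> // b /= ->.
- rewrite finsertions_cons forest_vertices_cons inE mem_cat map_cat all_cat /=.
  move=> uss /andP[it its] /andP[la las].
  case/or3P: uss => [/eqP ->|/mapP[t' t't ->]|/mapP[us' uss' ->]] /=.
  + by split=> [|b ba ->]; rewrite ?it ?its ?ba.
  + by rewrite (IHt _ t't it la) its; split=> // b _; rewrite (label_insertions _ _ _ t't).
  + have [-> h] := IHts _ uss' its las; rewrite it; split=> // b ba /andP[->]; exact: h.
Qed.

Lemma deletion_id a t : a \notin map label (vertices t) -> deletion a t = t.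
Proof.
suff [h _] : (forall t, a \notin map label (vertices t) -> deletion a t = t) /\
    (forall ts, a \notin map label (forest_vertices ts) -> fdeletion a ts = ts)
  by exact: h.
apply: ptree_forest_ind => {t} [b ts IH||t ts IHt IHts] //.
  by rewrite vertices_node /= inE negb_or => /andP[_ /IH ->].
rewrite forest_vertices_cons map_cat mem_cat negb_or => /andP[at_ /IHts] /= ->.
rewrite (IHt at_); case: eqP => // ta.
by rewrite -ta (map_f _ (root_vertices t)) in at_.
Qed.

Lemma forest_deletion_id a ts :
  a \notin map label (forest_vertices ts) -> fdeletion a ts = ts.
Proof.
elim: ts => // t ts IHts.
rewrite forest_vertices_cons map_cat mem_cat negb_or => /andP[at_ /IHts] /= ->.
rewrite (deletion_id _ _ at_); case: eqP => // ta.
by rewrite -ta (map_f _ (root_vertices t)) in at_.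
Qed.

(** Each insertion determines the original tree, so insertions into distinct trees are disjoint. *)
Lemma insertionsK a t t' : a \notin map label (vertices t) ->
  t' \in insertions (leaf a) t -> deletion a t' = t.
Proof.
suff [h _] : (forall t, forall t', a \notin map label (vertices t) ->
     t' \in insertions (leaf a) t -> deletion a t' = t) /\
    (forall ts, forall us, a \notin map label (forest_vertices ts) ->
     us \in finsertions (leaf a) ts -> fdeletion a us = ts)
  by exact: h.
apply: ptree_forest_ind => {t t'} [b ts IH t'|us _|t ts IHt IHts us].
- rewrite vertices_node /= inE negb_or => /andP[_ nts] /mapP[us uss ->] /=.
  by rewrite (IH us).
- by rewrite inE => /eqP -> /=; rewrite eqxx.
- rewrite forest_vertices_cons map_cat mem_cat negb_or => /andP[nt nts].
  have ta : (label t == a) = false.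
    by apply: contraNF nt => /eqP <-; rewrite (map_f _ (root_vertices t)).
  rewrite finsertions_cons inE mem_cat => /or3P[/eqP ->|/mapP[t' t't ->]|] /=.
  + by rewrite eqxx ta deletion_id// forest_deletion_id.
  + by rewrite (label_insertions _ _ _ t't) ta (IHt t')// forest_deletion_id.
  + by move=> /mapP[us' uss' ->] /=; rewrite ta deletion_id// (IHts us').
Qed.

(** The three kinds of positions in a forest are told apart by the head of the result: the new leaf,
    a head changed by the insertion, or the old head. *)
Lemma insertions_uniq a t :
  a \notin map label (vertices t) -> uniq (insertions (leaf a) t).
Proof.
suff [h _] : (forall t, a \notin map label (vertices t) -> uniq (insertions (leaf a) t)) /\
    (forall ts, a \notin map label (forest_vertices ts) -> uniq (finsertions (leaf a) ts))
  by exact: h.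
apply: ptree_forest_ind => {t} [b ts IH||t ts IHt IHts] //.
  rewrite vertices_node /= inE negb_or => /andP[_ nts].
  by rewrite map_inj_uniq ?IH// => us vs [].
rewrite forest_vertices_cons map_cat mem_cat negb_or => /andP[nt nts].
have ta : label t != a.
  by apply: contraNN nt => /eqP <-; rewrite (map_f _ (root_vertices t)).
have ins_t t' : t' \in insertions (leaf a) t -> t' != t.
  move=> /labels_insertions /perm_mem/(_ a); rewrite mem_head => at'.
  by apply: contraNneq nt => <-.
rewrite finsertions_cons cons_uniq cat_uniq !map_inj_uniq; last 2 first.
- by move=> us vs [].
- by move=> us vs [].
rewrite IHt// IHts// andbT mem_cat negb_or /=; apply/andP; split; last first.
  apply/hasPn => _ /mapP[us uss ->]; apply/negP => /mapP[t' /ins_t + [tt' _]].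
  by rewrite tt' eqxx.
apply/andP; split; apply/mapP => -[].
- by move=> t' /label_insertions h [lt _]; move: ta; rewrite -h -lt eqxx.
- by move=> us _ [h _]; rewrite -h eqxx in ta.
Qed.

(** As [a] labels exactly one vertex, a leaf below the root, deletion removes just this leaf and
    leaves the gap where it sat. In a forest, the count of [a] in the head decides where it lies. *)
Lemma deletionK a t : label t != a ->
  count_mem a (map label (vertices t)) = 1%N ->
  all (fun v => (label v == a) ==> nilp (children v)) (vertices t) ->
  t \in insertions (leaf a) (deletion a t).
Proof.
suff [h _] : (forall t, label t != a -> count_mem a (map label (vertices t)) = 1%N ->
     all (fun v => (label v == a) ==> nilp (children v)) (vertices t) ->
     t \in insertions (leaf a) (deletion a t)) /\
    (forall ts, count_mem a (map label (forest_vertices ts)) = 1%N ->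
     all (fun v => (label v == a) ==> nilp (children v)) (forest_vertices ts) ->
     ts \in finsertions (leaf a) (fdeletion a ts))
  by exact: h.
apply: ptree_forest_ind => {t} [b ts IH /= ba||t ts IHt IHts] //.
  rewrite (negPf ba) add0n /= => /IH h /h {}h.
  by apply/mapP; exists ts.
rewrite forest_vertices_cons map_cat count_cat all_cat.
have [ta|ta] := eqVneq (label t) a.
  move=> cnt /andP[/allP/(_ t (root_vertices t))/=].
  case: t ta cnt {IHt} => b us /= ->; rewrite eqxx /= => + /nilP us0.
  rewrite {}us0 => -[cnt] _.
  rewrite forest_deletion_id; last exact/count_memPn.
  by case: ts {IHts cnt} => [|t ts]; rewrite ?finsertions_cons mem_head.
move=> cnt /andP[lt lts] /=; rewrite (negPf ta) inE mem_cat.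
case ct : (count_mem a (map label (vertices t))) cnt => [|[|//]] cnt.
  rewrite deletion_id; last exact/count_memPn.
  by rewrite [X in [|| _, _ | X]]map_f ?orbT// IHts.
case: cnt => cnt; rewrite forest_deletion_id; last exact/count_memPn.
by rewrite [X in [|| _, X | _]](map_f (cons^~ ts)) ?orbT// IHt.
Qed.

Lemma increasing_deletion a t : increasing t -> increasing (deletion a t).
Proof.
suff [h _] : (forall t, increasing t -> increasing (deletion a t)) /\
    (forall ts, all increasing ts -> all increasing (fdeletion a ts) /\
     forall b, all (fun c => b < label c)%N ts ->
       all (fun c => b < label c)%N (fdeletion a ts))
  by exact: h.
apply: ptree_forest_ind => {t} [b ts IH||t ts IHt IHts] //.
  by rewrite /= !increasing_node => /andP[bts /IH[-> ->]].
move=> /= /andP[/IHt it /IHts[its h]]; case: ifP => _ /=.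
  by split=> // b /andP[_]; exact: h.
by rewrite it its; split=> // b; rewrite label_deletion => /andP[->]; exact: h.
Qed.

(** * Enumeration of plane increasing trees *)

Lemma plane_increasing1 t : plane_increasing 1 t = (t == leaf 1).
Proof.
apply/idP/eqP => [/andP[pt _]|->] //.
move/perm_size: (pt); case: t pt => b [|c ts].
  by rewrite /= => /perm_mem/(_ 1%N); rewrite !inE eqxx => /eqP <-.
by rewrite vertices_node forest_vertices_cons; case: c.
Qed.

Lemma plane_increasing_insertion n t t' : (0 < n)%N ->
  t' \in insertions (leaf n.+1) t -> plane_increasing n t -> plane_increasing n.+1 t'.
Proof.
move=> n0 t't /andP[pt it]; apply/andP; split.
  have -> : iota 1 n.+1 = rcons (iota 1 n) n.+1 by rewrite -[X in iota _ X]addn1 iotaD cats1 add1n.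
  rewrite perm_sym perm_rcons perm_sym.
  by rewrite (perm_trans (labels_insertions _ _ _ t't))// perm_cons.
apply: (increasing_insertions _ _ _ t't it).
by apply/allP => b; rewrite (perm_mem pt) mem_iota add1n => /andP[].
Qed.

Lemma plane_increasing_labels n t : plane_increasing n t ->
  n.+1 \notin map label (vertices t).
Proof. by move=> /andP[/perm_mem -> _]; rewrite mem_iota add1n ltnn andbF. Qed.

(** A child of the vertex n+1 would need a larger label, so this vertex is a leaf; were it the root,
    the tree would have one vertex, against n > 0. *)
Lemma plane_increasing_deletion n t : (0 < n)%N -> plane_increasing n.+1 t ->
  t \in insertions (leaf n.+1) (deletion n.+1 t) /\
  plane_increasing n (deletion n.+1 t).
Proof.
move=> n0 /andP[pt it].
have leaf_max : all (fun v => (label v == n.+1) ==> nilp (children v)) (vertices t).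
  apply/allP => v vt; apply/implyP => /eqP lv.
  case cv : (children v) => [//|c cs].
  have cvt : c \in vertices t by apply: (child_vertices _ _ _ vt); rewrite cv mem_head.
  have : label c \in iota 1 n.+1 by rewrite -(perm_mem pt) map_f.
  rewrite mem_iota add1n => /andP[_ lcn].
  move/allP: it => /(_ v vt)/allP/(_ c); rewrite cv mem_head lv => /(_ isT).
  by rewrite ltnNge -ltnS lcn.
have root_max : label t != n.+1.
  apply/eqP => lt; move/allP: leaf_max => /(_ t (root_vertices t)).
  rewrite lt eqxx /=; case: t pt {it lt} => b [|//] /perm_size /=.
  by case: n n0.
have cnt : count_mem n.+1 (map label (vertices t)) = 1%N.
  by rewrite (permP pt) count_uniq_mem ?iota_uniq// mem_iota add1n /= ltnSn.
have tin := deletionK _ _ root_max cnt leaf_max.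
split=> //; apply/andP; split; last exact: increasing_deletion.
rewrite -(perm_cons n.+1) -(permPl (labels_insertions _ _ _ tin)).
by rewrite (permPl pt) -[X in iota _ X]addn1 iotaD add1n cats1 perm_rcons.
Qed.

(** The enumeration by successive insertions starts at size 1, as there is no tree without
    vertices. *)
Fixpoint PIT_seq (n : nat) : seq ptree :=
  if n is m.+1 then
    if m is 0%N then [:: leaf 1] else flatten (map (insertions (leaf n)) (PIT_seq m))
  else [::].

Lemma mem_PIT_seq n t : (t \in PIT_seq n) = plane_increasing n t.
Proof.
case: n => [|n]; first by case: t => a ts; apply/esym/negP => /andP[/perm_size].
elim: n t => [|n IH] t; first by rewrite inE plane_increasing1.
apply/flatten_mapP/idP => [[s]|/plane_increasing_deletion[]// tin pd].
  by rewrite IH => ps ts; exact: plane_increasing_insertion ts ps.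
by exists (deletion n.+2 t); rewrite ?IH.
Qed.

Lemma PIT_seq_uniq n : uniq (PIT_seq n).
Proof.
case: n => // n; elim: n => // n IH.
have nl t : t \in PIT_seq n.+1 -> n.+2 \notin map label (vertices t).
  by rewrite mem_PIT_seq => /plane_increasing_labels.
(* Passing to sublists of the enumeration allows induction on the list; a common insertion of two of
   its trees would, by deletion, make them equal. *)
suff main s : uniq s -> {subset s <= PIT_seq n.+1} ->
    uniq (flatten (map (insertions (leaf n.+2)) s)) by exact: main.
elim: s => [//|t ts IHts] /= /andP[tts uts] sub.
have tP : t \in PIT_seq n.+1 by apply: sub; rewrite mem_head.
have tsP : {subset ts <= PIT_seq n.+1} by move=> s sts; apply: sub; rewrite inE sts orbT.
rewrite cat_uniq insertions_uniq ?nl// IHts// andbT /=.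
apply/hasPn => t' /flatten_mapP[s sts t's].
apply: contraNN tts => t't.
by rewrite -(insertionsK _ _ _ (nl t tP) t't) (insertionsK _ _ _ (nl _ (tsP _ sts)) t's).
Qed.

Lemma PIT_perm n : perm_eq (PIT n) (PIT_seq n).
Proof.
apply: uniq_perm; rewrite ?fset_uniq ?PIT_seq_uniq// => t.
rewrite /PIT; have -> : [set t | plane_increasing n t] = [set` PIT_seq n].
  by apply/seteqP; split=> s /=; rewrite mem_PIT_seq.
rewrite in_fset_set; last exact: finite_seq.
by rewrite mem_setE.
Qed.

(** * Label-blind statistics *)

Fixpoint unlabel (t : ptree) : ptree :=
  let: PNode _ ts := t in PNode 0 (map unlabel ts).

Definition label_blind (T : Type) (f : ptree -> T) :=
  forall t, f (unlabel t) = f t.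

Lemma unlabel_insertions a t :
  map unlabel (insertions (leaf a) t) = insertions (leaf 0) (unlabel t).
Proof.
suff [h _] : (forall t, map unlabel (insertions (leaf a) t) =
      insertions (leaf 0) (unlabel t)) /\
    (forall ts, map (map unlabel) (finsertions (leaf a) ts) =
      finsertions (leaf 0) (map unlabel ts))
  by exact: h.
apply: ptree_forest_ind => {t} [c ts IH||t ts IHt IHts] //.
  by rewrite [unlabel _]/= !insertions_node -IH -!map_comp.
rewrite finsertions_cons [in RHS]/= -IHt -IHts /= map_cat -!map_comp.
by congr (_ :: _ ++ _).
Qed.

Lemma size_vertices_unlabel t : size (vertices (unlabel t)) = size (vertices t).
Proof.
suff [h _] : (forall t, size (vertices (unlabel t)) = size (vertices t)) /\
    (forall ts, size (forest_vertices (map unlabel ts)) = size (forest_vertices ts))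
  by exact: h.
apply: ptree_forest_ind => {t} [c ts IH||t ts IHt IHts] //.
  by rewrite [unlabel _]/= !vertices_node /= IH.
by rewrite [map _ _]/= !forest_vertices_cons !size_cat IHt IHts.
Qed.

Lemma rank_label_blind : label_blind _ rank.
Proof.
have blind d t : leaf_at_depth d (unlabel t) = leaf_at_depth d t.
  elim: d t => [|d IH] [a ts] /=; first by case: ts.
  by rewrite has_map; apply: eq_has => t /=; exact: IH.
move=> t; rewrite /rank; case: ex_minnP => m lm minm; case: ex_minnP => m' lm' minm'.
apply/eqP; rewrite eqn_leq; apply/andP; split.
  by apply: minm; rewrite blind.
by apply: minm'; rewrite -blind.
Qed.

Section label_blind_sums.
Context {R : realType}.
Implicit Types f g : ptree -> R.

(** The fixed label 0 makes this an operator on statistics that does not depend on n; for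
    label-blind [f] any label gives the same sum. *)
Definition insertion_sum f (t : ptree) : R :=
  \sum_(s <- insertions (leaf 0) t) f s.

Lemma insertion_sumE f a t : label_blind _ f ->
  \sum_(s <- insertions (leaf a) t) f s = insertion_sum f (unlabel t).
Proof.
move=> bf; rewrite /insertion_sum -(unlabel_insertions a) big_map.
by apply: eq_bigr => s _; rewrite bf.
Qed.

Lemma label_blind_insertion_sum f : label_blind _ f -> label_blind _ (insertion_sum f).
Proof. by move=> bf t; rewrite -(insertion_sumE _ 0). Qed.

Let tsize (t : ptree) : R := (size (vertices t))%:R.

Lemma size_insertionsR a t : (size (insertions (leaf a) t))%:R = 2 * tsize t - 1 :> R.
Proof. by rewrite /tsize -natrM -(size_insertions (leaf a)) -natr1 addrK. Qed.

Lemma sumr_const_seq (T : Type) (s : seq T) (x : R) :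
  \sum_(i <- s) x = (size s)%:R * x.
Proof. by rewrite big_const_seq iter_addr_0 count_predT mulr_natl. Qed.

(* The new leaf lands in the subtree of a given vertex v of t in 2|v| - 1 of the
   2|t| - 1 cases; in the remaining 2(|t| - |v|) cases that subtree is unchanged. *)
Lemma sum_vertices_insertions f a t : label_blind _ f ->
  \sum_(s <- insertions (leaf a) t) \sum_(v <- vertices s) f v =
  (2 * tsize t - 1) * f (leaf 0) +
  \sum_(v <- vertices t) (2 * (tsize t - tsize v) * f v + insertion_sum f v).
Proof.
move=> bf.
(* First let every position count all old subtrees as unchanged. For the positions inside the
   subtree [v] this contributes [W v], to be replaced by [insertion_sum f v]. *)
pose W v := (2 * tsize v - 1) * f v.
have leafE b : f (leaf b) = f (leaf 0) by rewrite -(bf (leaf b)).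
suff [h _] : (forall t, \sum_(s <- insertions (leaf a) t) \sum_(v <- vertices s) f v =
      (2 * tsize t - 1) * (f (leaf 0) + \sum_(v <- vertices t) f v) +
      \sum_(v <- vertices t) (insertion_sum f v - W v)) /\
    (forall ts, \sum_(us <- finsertions (leaf a) ts) \sum_(v <- forest_vertices us) f v =
      (2 * (size (forest_vertices ts))%:R + 1) *
        (f (leaf 0) + \sum_(v <- forest_vertices ts) f v) +
      \sum_(v <- forest_vertices ts) (insertion_sum f v - W v)).
  rewrite h mulrDr -addrA mulr_sumr -big_split /=; congr (_ + _).
  by apply: eq_bigr => v _; rewrite /W; ring.
apply: ptree_forest_ind => {t} [b ts IH||t ts IHt IHts].
- rewrite insertions_node big_map.
  under eq_bigr do rewrite vertices_node big_cons.
  rewrite big_split /= IH.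
  have -> : \sum_(us <- finsertions (leaf a) ts) f (PNode b us) =
      insertion_sum f (PNode b ts).
    by rewrite -label_blind_insertion_sum// -(insertion_sumE _ a)// insertions_node big_map.
  have -> : tsize (PNode b ts) = (size (forest_vertices ts))%:R + 1.
    by rewrite /tsize vertices_node /= natr1.
  rewrite -/(forest_vertices ts) !big_cons [W (PNode _ _)]/W.
  have -> : tsize (PNode b ts) = (size (forest_vertices ts))%:R + 1.
    by rewrite /tsize vertices_node /= natr1.
  by ring.
- by rewrite !big_seq1 !big_nil leafE mulr0 add0r mul1r !addr0.
- have fvE x us : \sum_(v <- forest_vertices (x :: us)) f v =
      \sum_(v <- vertices x) f v + \sum_(v <- forest_vertices us) f v.
    by rewrite forest_vertices_cons big_cat.
  rewrite finsertions_cons big_cons !fvE [X in _ + X = _]big_cat.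
  rewrite (big_map (cons^~ ts)) (big_map (cons t)).
  rewrite (eq_bigr _ (fun x _ => fvE x ts)) (eq_bigr _ (fun us _ => fvE t us)).
  rewrite [X in _ + (X + _) = _]big_split [X in _ + (_ + X) = _]big_split.
  rewrite IHt IHts forest_vertices_cons [in RHS]big_cat /=.
  rewrite !sumr_const_seq size_finsertions big_seq1 leafE.
  rewrite size_insertionsR size_cat natrD -[(2 * _).+1%:R]natr1 natrM /tsize.
  by ring.
Qed.

(** * Recursion in n for means over all trees *)

Definition PIT_sum (n : nat) f : R := \sum_(t <- PIT_seq n) f t.
Definition PIT_vertex_sum (n : nat) f : R :=
  PIT_sum n (fun t => \sum_(v <- vertices t) f v).

Lemma PIT_sumS n f : label_blind _ f ->
  PIT_sum n.+2 f = PIT_sum n.+1 (insertion_sum f).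
Proof.
move=> bf; rewrite /PIT_sum [PIT_seq n.+2]/= big_flatten big_map.
by apply: eq_bigr => t _; rewrite insertion_sumE// label_blind_insertion_sum.
Qed.

Lemma size_PIT_tree n t : t \in PIT_seq n.+1 -> size (vertices t) = n.+1.
Proof.
by rewrite mem_PIT_seq => /andP[/perm_size + _]; rewrite size_map size_iota.
Qed.

Lemma size_PIT_seqS n : size (PIT_seq n.+2) = (n.*2.+1 * size (PIT_seq n.+1))%N.
Proof.
rewrite [PIT_seq n.+2]/= size_flatten sumnE big_map big_map.
rewrite (eq_big_seq (fun=> n.*2.+1)).
  by rewrite big_const_seq count_predT iter_addn_0.
move=> t /size_PIT_tree st; apply: succn_inj; rewrite size_insertions st.
by rewrite mul2n doubleS.
Qed.

Lemma size_PIT_seq_gt0 n : (0 < size (PIT_seq n.+1))%N.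
Proof. by elim: n => // n IH; rewrite size_PIT_seqS muln_gt0. Qed.

Let sizeP (n : nat) : R := (size (PIT_seq n.+1))%:R.

Let sizeP_neq0 n : sizeP n != 0.
Proof. by rewrite pnatr_eq0 -lt0n size_PIT_seq_gt0. Qed.

Let sizePS n : sizeP n.+1 = (2 * n%:R + 1) * sizeP n.
Proof. by rewrite /sizeP size_PIT_seqS natrM -natr1 -mul2n natrM. Qed.

(** On trees of size n+1 the insertion count turns into a vertex sum of a new statistic, so the
    recursion stays among vertex sums while the statistic changes. *)
Lemma PIT_vertex_sumS n f : label_blind _ f ->
  PIT_vertex_sum n.+2 f = (2 * n%:R + 1) * sizeP n * f (leaf 0) +
    PIT_vertex_sum n.+1 (fun v => 2 * (n.+1%:R - tsize v) * f v + insertion_sum f v).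
Proof.
move=> bf; rewrite /PIT_vertex_sum /PIT_sum [PIT_seq n.+2]/= big_flatten big_map.
rewrite (eq_big_seq (fun t => (2 * n%:R + 1) * f (leaf 0) +
  \sum_(v <- vertices t) (2 * (n.+1%:R - tsize v) * f v + insertion_sum f v))).
  by rewrite big_split sumr_const_seq; congr (_ + _); rewrite mulrCA mulrA.
move=> t tP; rewrite sum_vertices_insertions// /tsize (size_PIT_tree _ _ tP).
by rewrite -natr1; congr (_ + _); ring.
Qed.

(** The index is shifted by one: this is the mean over the trees on [n+1]. *)
Definition root_mean f (n : nat) : R := PIT_sum n.+1 f / (size (PIT_seq n.+1))%:R.

Lemma PIT_vertex_mean f n : label_blind _ f ->
  PIT_vertex_sum n.+1 f / (size (PIT_seq n.+1))%:R = root_mean f n +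
  (2 * n%:R + 1) *
    \sum_(0 <= j < n) root_mean f j / ((2 * j%:R + 1) * (2 * j%:R + 3)).
Proof.
rewrite -/(sizeP n).
elim: n f => [|n IH] f bf.
  rewrite big_geq// mulr0 addr0 /root_mean /PIT_vertex_sum /PIT_sum /= !big_seq1.
  by [].
(* The induction hypothesis is applied to [g], whose root means combine those of [f] at two
   consecutive sizes. *)
set g := fun v => 2 * (n.+1%:R - tsize v) * f v + insertion_sum f v.
have bg : label_blind _ g.
  by move=> t; rewrite /g /tsize size_vertices_unlabel bf label_blind_insertion_sum.
have n1 k : 2 * k%:R + 1 != 0 :> R.
  by rewrite gt_eqF// ltr_wpDl// mulr_ge0.
have n3 k : 2 * k%:R + 3 != 0 :> R.
  by rewrite gt_eqF// ltr_wpDl// mulr_ge0.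
have meang m : root_mean g m =
    2 * (n%:R - m%:R) * root_mean f m + (2 * m%:R + 1) * root_mean f m.+1.
  rewrite /root_mean -/(sizeP m) -/(sizeP m.+1) sizePS PIT_sumS//.
  have -> : PIT_sum m.+1 g =
      2 * (n%:R - m%:R) * PIT_sum m.+1 f + PIT_sum m.+1 (insertion_sum f).
    rewrite /PIT_sum mulr_sumr -big_split /=; apply: eq_big_seq => t tP.
    by rewrite /g /tsize (size_PIT_tree _ _ tP) -!natr1; ring.
  by field; rewrite sizeP_neq0 n1.
rewrite PIT_vertex_sumS// -/g sizePS.
have -> : ((2 * n%:R + 1) * sizeP n * f (leaf 0) + PIT_vertex_sum n.+1 g) /
    ((2 * n%:R + 1) * sizeP n) =
    f (leaf 0) + (PIT_vertex_sum n.+1 g / sizeP n) / (2 * n%:R + 1).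
  by field; rewrite sizeP_neq0 n1.
rewrite IH// meang subrr mulr0 mul0r add0r.
have -> : f (leaf 0) = root_mean f 0.
  by rewrite /root_mean /PIT_sum /= big_seq1 divr1 -[RHS]bf.
set p := root_mean f.
pose T N := \sum_(0 <= j < N) p j / ((2 * j%:R + 1) * (2 * j%:R + 3)).
(* Over the common denominator [p j] has the coefficient 2(n - j) + (2j + 3) = 2n + 3, except at the
   two ends. The boundary term [- p 0] cancels the contribution of the new leaf. *)
have key N : \sum_(0 <= j < N) root_mean g j / ((2 * j%:R + 1) * (2 * j%:R + 3)) =
    (2 * n%:R + 3) * T N + p N / (2 * N%:R + 1) - p 0%N.
  elim: N => [|N IHN].
    by rewrite /T !big_geq// mulr0 add0r mulr0 add0r divr1 subrr.
  rewrite /T !big_nat_recr//= IHN -/(T N) meang -natr1 -/p; field.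
  have -> : 2 * (1 + N%:R) + 1 = 2 * N%:R + 3 :> R by ring.
  by rewrite n1 n3.
rewrite -/(T n.+1) /T big_nat_recr//= -/(T n) key -natr1; field.
by rewrite n1 n3.
Qed.
End label_blind_sums.

(** * Moments of the square root weight *)

Section sqrt_moments.
Context {R : realType}.
Local Notation mu := (@lebesgue_measure R).

Definition sqrt_weight (x : R) : R := Num.sqrt (1 - 2 * x).

Lemma continuous_sqrt_weight : continuous sqrt_weight.
Proof.
move=> x; apply: (@continuous_comp _ _ _ (fun x : R => 1 - 2 * x) Num.sqrt).
  by apply: cvgB; [exact: cvg_cst|apply: cvgM; [exact: cvg_cst|exact: cvg_id]].
exact: sqrt_continuous.
Qed.

Lemma continuous_sqrt_moment m : continuous (fun x : R => sqrt_weight x * x ^+ m).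
Proof.
by move=> x; apply: cvgM; [exact: continuous_sqrt_weight|exact: exprn_continuous].
Qed.

Lemma integrable_sqrt_moment m (a b : R) :
  mu.-integrable `[a, b] (EFin \o (fun x => sqrt_weight x * x ^+ m)).
Proof.
apply: continuous_compact_integrable; first exact: segment_compact.
exact/continuous_subspaceT/continuous_sqrt_moment.
Qed.

Definition sqrt_moment m : R := \int[mu]_(x in `[0, 2^-1]) (sqrt_weight x * x ^+ m).

(** This is x^m (1 - 2x)^(3/2) on the interval: it vanishes at 1/2, and its derivative combines two
    consecutive moment integrands. *)
Let primitive m (x : R) : R := x ^+ m * ((1 - 2 * x) * sqrt_weight x).

Let primitive_continuous m : continuous (primitive m).
Proof.
move=> x; apply: cvgM; first exact: exprn_continuous.
apply: cvgM; last exact: continuous_sqrt_weight.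
by apply: cvgB; [exact: cvg_cst|apply: cvgM; [exact: cvg_cst|exact: cvg_id]].
Qed.

Let is_derive_primitive (m : nat) (x : R) : x < 2^-1 -> is_derive x 1 (primitive m)
  (m%:R * (sqrt_weight x * x ^+ m.-1) - (2 * m%:R + 3) * (sqrt_weight x * x ^+ m)).
Proof.
move=> x2; have y0 : 0 < 1 - 2 * x by lra.
have dlin : is_derive x 1 (fun x : R => 1 - 2 * x) (- 2).
  apply: is_derive_eq; rewrite /GRing.scale /=; ring.
have dsqrt : is_derive x 1 sqrt_weight (- (sqrt_weight x)^-1).
  have := @is_derive1_comp R Num.sqrt (fun x => 1 - 2 * x) x _ _
    (is_derive1_sqrt y0) dlin.
  move=> h; apply: is_derive_eq; rewrite /sqrt_weight invfM; field.
  by rewrite gt_eqF// sqrtr_gt0.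
have dX : is_derive x 1 (fun x : R => x ^+ m) (m%:R * x ^+ m.-1).
  by apply: DeriveDef; [exact: exprn_derivable|rewrite exp_derive /GRing.scale /= mulr1].
have s0 : sqrt_weight x != 0 by rewrite gt_eqF// sqrtr_gt0.
have sE : 1 - 2 * x = sqrt_weight x ^+ 2 by rewrite sqr_sqrtr// ltW.
have -> : primitive m = (fun x : R => x ^+ m) * ((fun x : R => 1 - 2 * x) * sqrt_weight).
  by [].
apply: is_derive_eq; rewrite /GRing.scale /= fctE.
case: m {dX} => [|m].
  by rewrite !mul0r !mulr0 !expr0 !mul1r sE; field.
rewrite [m.+1.-1]/= !exprS -natr1; move: (x ^+ m) (sqrt_weight x) s0 sE => y s s0 sE.
(* Eliminating [x] in favour of the square root [s] leaves a rational identity. *)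
have -> : x = (1 - s ^+ 2) / 2 by rewrite -sE; field.
by field.
Qed.

(** The right-hand side is minus the value of the primitive at 0. For m = 0 the term with [m.-1] has
    coefficient 0. *)
Lemma sqrt_moment_eq m :
  m%:R * sqrt_moment m.-1 - (2 * m%:R + 3) * sqrt_moment m = - (m == 0%N)%:R.
Proof.
rewrite /sqrt_moment -!RintegralZl//; [|exact: integrable_sqrt_moment..].
have cZ (c : R) k : continuous (fun x : R => c * (sqrt_weight x * x ^+ k)).
  by move=> x; apply: cvgM; [exact: cvg_cst|exact: continuous_sqrt_moment].
have iZ (c : R) k :
    mu.-integrable `[0, 2^-1] (EFin \o (fun x => c * (sqrt_weight x * x ^+ k))).
  apply: continuous_compact_integrable; first exact: segment_compact.
  exact/continuous_subspaceT/cZ.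
rewrite -RintegralB//.
rewrite /Rintegral (@continuous_FTC2 _ _ (primitive m))//.
- rewrite /primitive /sqrt_weight mulfV// subrr mul0r mulr0 mulr0 subr0 sqrtr1 mulr1 mulr1.
  by rewrite -EFinB /= expr0n sub0r.
- apply: continuous_subspaceT => x; apply: cvgB; exact: cZ.
- split.
  + move=> x; rewrite in_itv/= => /andP[_ x2].
    by have [] := is_derive_primitive m x x2.
  + exact/cvg_at_right_filter/primitive_continuous.
  + exact/cvg_at_left_filter/primitive_continuous.
- move=> x; rewrite in_itv/= => /andP[_ x2].
  by rewrite derive1E; have [_ ->] := is_derive_primitive m x x2.
Qed.

Lemma sqrt_momentE m :
  sqrt_moment m = m`!%:R / \prod_(0 <= i < m.+2) (2 * i%:R + 1).
Proof.
elim: m => [|m IH].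
  have := sqrt_moment_eq 0; rewrite !big_nat_recl// big_geq// fact0 /=.
  have -> : (2 * 0 + 1) * ((2 * 1 + 1) * 1) = 3 :> R by ring.
  by move=> h; lra.
have := sqrt_moment_eq m.+1; rewrite /= oppr0 => /subr0_eq.
have n5 : 2 * m.+1%:R + 3 != 0 :> R by rewrite gt_eqF// ltr_wpDl// mulr_ge0.
move=> h; rewrite -[LHS](mulKf n5) -h IH [in RHS]big_nat_recr//= factS natrM.
have -> : 2 * m.+2%:R + 1 = 2 * m.+1%:R + 3 :> R by rewrite -[m.+2%:R]natr1; ring.
rewrite invfM; ring.
Qed.

End sqrt_moments.

(** * Power series *)

Section power_series.
Context {R : realType}.

Lemma is_cvg_pseries_geometric (c : nat -> R) (M r x : R) :
  (forall n, `|c n| <= M * r ^+ n) -> 0 <= r -> `|x| * r < 1 -> cvgn (pseries c x).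
Proof.
move=> cM r0 xr; apply: normed_cvg.
have M0 : 0 <= M by have := cM 0%N; rewrite mulr1; apply: le_trans.
have : cvgn (series (geometric M (`|x| * r))).
  by apply: is_cvg_geometric_series; rewrite ger0_norm// mulr_ge0.
apply: series_le_cvg => n //=; first by rewrite mulr_ge0// exprn_ge0// mulr_ge0.
rewrite normrM normrX exprMn mulrCA mulrC; apply: ler_wpM2l; last exact: cM.
exact: exprn_ge0.
Qed.

(** The factor n + 1 is absorbed by any larger ratio s = r(1 + d): Bernoulli's inequality gives n +
    1 <= (1 + 1/d)(1 + d)^n. *)
Lemma pseries_diffs_geometric (c : nat -> R) (M r s : R) :
  (forall n, `|c n| <= M * r ^+ n) -> 0 < r -> r < s ->
  exists M', forall n, `|pseries_diffs c n| <= M' * s ^+ n.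
Proof.
move=> cM r0 rs; pose d := s / r - 1.
have d0 : 0 < d by rewrite subr_gt0 ltr_pdivlMr// mul1r.
have M0 : 0 <= M by have := cM 0%N; rewrite mulr1; apply: le_trans.
exists (M * r * (1 + d^-1)) => n.
rewrite /pseries_diffs normrM ger0_norm//.
have sE : s = r * (1 + d) by rewrite /d; field; rewrite gt_eqF.
have bern : n.+1%:R <= (1 + d^-1) * (1 + d) ^+ n.
  apply: (@le_trans _ _ ((1 + d^-1) * (1 + n%:R * d))).
    have -> : (1 + d^-1) * (1 + n%:R * d) = n.+1%:R + (d^-1 + n%:R * d).
      by rewrite -natr1; field; rewrite gt_eqF.
    by rewrite lerDl addr_ge0// ?invr_ge0 ?mulr_ge0// ltW.
  apply: ler_wpM2l; first by rewrite addr_ge0// invr_ge0 ltW.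
  elim: n => [|n IH]; first by rewrite mul0r addr0.
  rewrite exprS; apply: le_trans (ler_wpM2l _ IH); last by rewrite addr_ge0// ltW.
  rewrite -natr1 -subr_ge0.
  have -> : (1 + d) * (1 + n%:R * d) - (1 + (n%:R + 1) * d) = n%:R * d ^+ 2 by ring.
  by rewrite mulr_ge0// sqr_ge0.
apply: le_trans (ler_wpM2l _ (cM n.+1)) _ => //.
rewrite sE exprMn exprS.
have -> : M * r * (1 + d^-1) * (r ^+ n * (1 + d) ^+ n) =
  ((1 + d^-1) * (1 + d) ^+ n) * (M * (r * r ^+ n)) by ring.
by apply: ler_wpM2r => //; rewrite mulr_ge0// mulr_ge0 ?exprn_ge0// ltW.
Qed.

Lemma pseries_derive (c : nat -> R) (M r x : R) :
  (forall n, `|c n| <= M * r ^+ n) -> 0 < r -> `|x| * r < 1 ->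
  cvgn (pseries (pseries_diffs c) x) /\
  derive1 (fun y => limn (pseries c y)) x = limn (pseries (pseries_diffs c) x).
Proof.
move=> cM r0 xr.
have x1 : 0 < 1 + `|x| * r by rewrite ltr_wpDr// mulr_ge0// ltW.
(* [K] is the midpoint of |x| and 1/r. *)
pose K := (1 + `|x| * r) / (2 * r).
have K0 : 0 < K by rewrite divr_gt0// mulr_gt0.
have xK : `|x| < K by rewrite ltr_pdivlMr ?mulr_gt0//; lra.
have rK : r < K^-1.
  by rewrite -[X in X < _]invrK ltf_pV2 ?posrE ?invr_gt0// ltr_pdivrMr ?mulr_gt0//
     mulrCA mulVf ?gt_eqF//; lra.
(* Termwise differentiation asks for convergence at [K] of the series and of its first two formal
   derivatives; each derivative costs one larger ratio, still below 1/K. *)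
pose s1 := r + (K^-1 - r) / 3; pose s2 := r + (K^-1 - r) / 3 * 2.
have rs1 : r < s1 by rewrite /s1; lra.
have s12 : s1 < s2 by rewrite /s1 /s2; lra.
have s2K : s2 < K^-1 by rewrite /s2; lra.
have [M1 cM1] := pseries_diffs_geometric _ _ _ _ cM r0 rs1.
have s10 : 0 < s1 by exact: lt_trans rs1.
have [M2 cM2] := pseries_diffs_geometric _ _ _ _ cM1 s10 s12.
have Ks s : s < K^-1 -> `|K| * s < 1.
  by move=> sK; rewrite gtr0_norm// -(mulfV (lt0r_neq0 K0)) ltr_pM2l.
have cv1 : cvgn (pseries (pseries_diffs c) K).
  by apply: is_cvg_pseries_geometric cM1 (ltW s10) (Ks _ (lt_trans s12 s2K)).
have xK' : `|x| < `|K| by rewrite (gtr0_norm K0).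
split; first exact: is_cvg_pseries_inside cv1 xK'.
rewrite derive1E; apply: derive_val; apply: (@pseries_snd_diffs _ _ K) => //.
  by apply: is_cvg_pseries_geometric cM (ltW r0) (Ks _ rK).
by apply: is_cvg_pseries_geometric cM2 (ltW (lt_trans s10 s12)) (Ks _ s2K).
Qed.

(* Termwise integration is monotone convergence, the terms being nonnegative. *)
Lemma integral_sqrt_weight_pseries (c : nat -> R) (M : R) :
  (forall n, 0 <= c n <= M * 2 ^+ n) ->
  cvgn (series (fun n => pseries_diffs c n * sqrt_moment n)) ->
  \int[@lebesgue_measure R]_(x in `[0, 2^-1])
    (Num.sqrt (1 - 2 * x) * derive1 (fun y => limn (pseries c y)) x) =
  limn (series (fun n => pseries_diffs c n * sqrt_moment n)).
Proof.
move=> cM cvm.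
have c0 n : 0 <= c n by case/andP: (cM n).
have d0 n : 0 <= pseries_diffs c n by rewrite mulr_ge0.
have cM' n : `|c n| <= M * 2 ^+ n by rewrite ger0_norm//; case/andP: (cM n).
pose h x := Num.sqrt (1 - 2 * x) * derive1 (fun y => limn (pseries c y)) x.
pose u n (x : R) : R := pseries_diffs c n * (sqrt_weight x * x ^+ n).
(* The coefficient bound controls the series only below 1/2; the endpoint is a null set. *)
have D2 x : x \in `[0, 2^-1[ -> (h x)%:E = (\sum_(n <oo) (u n x)%:E)%E.
  rewrite in_itv/= => /andP[x0 x2].
  have x21 : `|x| * 2 < 1 by rewrite ger0_norm//; lra.
  have [cvx dE] := pseries_derive c M 2 x cM' (ltr0Sn _ _) x21.
  rewrite /h dE -/(sqrt_weight x) /u.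
  under eq_eseriesr do rewrite mulrCA EFinM.
  rewrite nneseriesZl; last first.
    by move=> n _; rewrite lee_fin mulr_ge0// exprn_ge0.
  rewrite EFinM -EFin_lim//; congr (_ * limn _)%E.
  by apply/funext => n; rewrite /= sumEFin.
have mu_ n : measurable_fun `[(0:R), 2^-1[ (EFin \o u n).
  apply/measurable_EFinP/measurable_funTS; apply: continuous_measurable_fun => x.
  by apply: cvgM; [exact: cvg_cst|exact: continuous_sqrt_moment].
have u0 n x : x \in `[0, 2^-1[ -> (0 <= (u n x)%:E)%E.
  rewrite in_itv/= => /andP[x0 _].
  by rewrite lee_fin mulr_ge0// mulr_ge0 ?sqrtr_ge0 ?exprn_ge0.
rewrite /Rintegral -[RHS]/(fine (limn _)%:E) -(EFin_lim cvm).
rewrite -[X in fine X = _]integral_itv_bndo_bndc; last first.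
  apply: (@eq_measurable_fun _ _ _ _ _ (fun x => \sum_(n <oo) (u n x)%:E)%E).
    by move=> x; rewrite inE => xD; rewrite -D2.
  by apply: ge0_emeasurable_sum => [n x xD _|n _]; [exact: u0|exact: mu_].
transitivity (fine (\int[@lebesgue_measure R]_(x in `[0%R, 2^-1%R[)
    (\sum_(n <oo) (u n x)%:E))%E).
  by congr fine; apply: eq_integral => x; rewrite inE => xD; rewrite -D2.
rewrite integral_nneseries//.
congr (fine (limn _)).
apply/funext => n; rewrite /= -sumEFin; apply: eq_bigr => i _.
rewrite integral_itv_bndo_bndc; last exact: mu_.
rewrite /sqrt_moment -RintegralZl//; last exact: integrable_sqrt_moment.
rewrite /Rintegral fineK//; apply: integrable_fin_num => //.
apply: continuous_compact_integrable; first exact: segment_compact.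
apply: continuous_subspaceT => x.
by apply: cvgM; [exact: cvg_cst|exact: continuous_sqrt_moment].
Qed.
End power_series.

(** * Telescoping weights *)

Section telescoping_weights.
Context {R : realType} (p : nat -> R).
Hypothesis p01 : forall j, 0 <= p j <= 1.

Let w j : R := p j / ((2 * j%:R + 1) * (2 * j%:R + 3)).

Let odd1_gt0 j : 0 < 2 * j%:R + 1 :> R.
Proof. by rewrite ltr_wpDl// mulr_ge0. Qed.

Let odd3_gt0 j : 0 < 2 * j%:R + 3 :> R.
Proof. by rewrite ltr_wpDl// mulr_ge0. Qed.

Let w_ge0 j : 0 <= w j.
Proof. by have /andP[p0 _] := p01 j; rewrite divr_ge0// mulr_ge0// ltW. Qed.

(** As p j <= 1, the weight is at most half of 1/(2j+1) - 1/(2j+3), and these bounds telescope. *)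
Let series_w_le m n : (m <= n)%N ->
  series w n - series w m <= 2^-1 * ((2 * m%:R + 1)^-1 - (2 * n%:R + 1)^-1).
Proof.
elim: n => [|n IH].
  by rewrite leqn0 => /eqP ->; rewrite !subrr mulr0.
rewrite leq_eqVlt => /orP[/eqP ->|]; first by rewrite !subrr mulr0.
rewrite ltnS => /IH {}IH; rewrite seriesS -[n.+1%:R]natr1.
have wn : w n <= 2^-1 * ((2 * n%:R + 1)^-1 - (2 * (n%:R + 1) + 1)^-1).
  have -> : 2^-1 * ((2 * n%:R + 1)^-1 - (2 * (n%:R + 1) + 1)^-1) =
      1 / ((2 * n%:R + 1) * (2 * n%:R + 3)) :> R.
    have := odd3_gt0 n; have := odd1_gt0 n => h1 h3.
    by field; rewrite !gt_eqF//; lra.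
  rewrite ler_pM2r ?invr_gt0 ?mulr_gt0//; by case/andP: (p01 n).
move: IH wn; move: (2 * m%:R + 1)^-1 (2 * n%:R + 1)^-1 (2 * (n%:R + 1) + 1)^-1.
by move=> a b c; lra.
Qed.

Let series_w_mono : {homo series w : m n / (m <= n)%N >-> m <= n}.
Proof. by apply: nondecreasing_series => n _ _; exact: w_ge0. Qed.

Lemma is_cvg_telescoping_weights : cvgn (series w).
Proof.
apply: nondecreasing_is_cvgn; first exact: series_w_mono.
exists 1 => _ [n _ <-]; have := series_w_le 0 n (leq0n n).
rewrite [series w 0]/series /= big_geq// subr0 mulr0 add0r invr1 => /le_trans; apply.
have : 0 <= (2 * n%:R + 1)^-1 :> R by rewrite invr_ge0 ltW.
by lra.
Qed.

Lemma telescoping_weights_tail n :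
  0 <= limn (series w) - series w n <= 2^-1 * (2 * n%:R + 1)^-1.
Proof.
rewrite subr_ge0 nondecreasing_cvgn_le//=; last exact: is_cvg_telescoping_weights.
rewrite lerBlDr; apply: limr_le; first exact: is_cvg_telescoping_weights.
near=> m.
have nm : (n <= m)%N by near: m; exists n.
have := series_w_le n m nm.
have : 0 <= (2 * m%:R + 1)^-1 :> R by rewrite invr_ge0 ltW.
by lra.
Unshelve. all: by end_near. Qed.

(** One positive weight suffices; positivity of the sum is what permits a relative error term. *)
Lemma telescoping_weights_gt0 k : 0 < p k -> 0 < limn (series w).
Proof.
move=> pk; have /andP[+ _] := telescoping_weights_tail k.+1.
rewrite subr_ge0; apply: lt_le_trans; rewrite seriesS ltr_pwDl//.
  by rewrite divr_gt0// mulr_gt0.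
by rewrite /series /= sumr_ge0.
Qed.

End telescoping_weights.

(** * Trees with a root of given rank *)

(** With a = 1 this is the witness that some tree on [k+1] has a root of rank k. *)
Fixpoint path_tree (a k : nat) : ptree :=
  if k is k'.+1 then PNode a [:: path_tree a.+1 k'] else leaf a.

Lemma labels_path_tree a k : map label (vertices (path_tree a k)) = iota a k.+1.
Proof.
elim: k a => [//|k IH] a.
by rewrite [path_tree _ _]/= vertices_node /forest_vertices /= cats0 IH.
Qed.

Lemma plane_increasing_path k : plane_increasing k.+1 (path_tree 1 k).
Proof.
rewrite /plane_increasing labels_path_tree perm_refl /=.
elim: k 1%N => [//|k IH] a; rewrite [path_tree _ _]/= increasing_node /= IH andbT.
by case: k {IH} => [|k] /=; rewrite ltnSn.
Qed.

Lemma rank_path a k : rank (path_tree a k) = k.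
Proof.
have leafE d : leaf_at_depth d (path_tree a k) = (d == k).
  by elim: k a d => [|k IH] a [|d] //=; rewrite orbF IH.
by rewrite /rank; case: ex_minnP => m; rewrite leafE => /eqP.
Qed.

Section root_rank.
Context {R : realType} (k : nat).

Definition rank_indicator (t : ptree) : R := (rank t == k)%:R.

Lemma label_blind_rank_indicator : label_blind _ rank_indicator.
Proof. by move=> t; rewrite /rank_indicator rank_label_blind. Qed.

Lemma sum_rank_indicator (s : seq ptree) :
  \sum_(t <- s) rank_indicator t = (count (fun t => rank t == k) s)%:R.
Proof.
by elim: s => [|t s IH]; rewrite ?big_nil// big_cons IH /= natrD.
Qed.

Lemma num_root_rankE n : num_root_rank k n = count (fun t => rank t == k) (PIT_seq n).
Proof.
rewrite -size_filter; apply: perm_size; apply: uniq_perm.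
- exact: fset_uniq.
- by rewrite filter_uniq// PIT_seq_uniq.
- by move=> t; rewrite mem_filter !inE /= (perm_mem (PIT_perm n)) andbC.
Qed.

Lemma root_mean_rankE n :
  root_mean rank_indicator n = (num_root_rank k n.+1)%:R / (size (PIT_seq n.+1))%:R.
Proof. by rewrite /root_mean /PIT_sum sum_rank_indicator num_root_rankE. Qed.

Lemma root_mean_rank01 n : 0 <= root_mean rank_indicator n <= 1.
Proof.
rewrite root_mean_rankE divr_ge0//= ler_pdivrMr ?ltr0n ?size_PIT_seq_gt0//.
by rewrite mul1r ler_nat num_root_rankE count_size.
Qed.

Lemma root_mean_rank_gt0 : 0 < root_mean rank_indicator k.
Proof.
rewrite root_mean_rankE divr_gt0// ltr0n ?size_PIT_seq_gt0// num_root_rankE.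
rewrite -has_count; apply/hasP; exists (path_tree 1 k); last by rewrite rank_path.
by rewrite mem_PIT_seq plane_increasing_path.
Qed.

Lemma PIT_expectation_num_rank n :
  PIT_expectation n (fun t => (num_rank k t)%:R) =
  PIT_vertex_sum n rank_indicator / (size (PIT_seq n))%:R.
Proof.
rewrite /PIT_expectation (perm_big _ (PIT_perm n)) (perm_size (PIT_perm n)).
by congr (_ / _); apply: eq_bigr => t _; rewrite sum_rank_indicator.
Qed.

(** The product is the double factorial (2n-1)!!. *)
Lemma size_PIT_seqE n :
  (size (PIT_seq n.+1))%:R = \prod_(0 <= i < n) (2 * i%:R + 1) :> R.
Proof.
elim: n => [|n IH]; first by rewrite big_geq.
by rewrite size_PIT_seqS natrM IH big_nat_recr//= mulrC -[n.*2.+1%:R]natr1 -mul2n natrM.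
Qed.

(** This bounds the coefficients of the generating function by 2^n, hence gives convergence for |z|
    < 1/2. *)
Lemma size_PIT_seq_le n : (size (PIT_seq n) <= 2 ^ n * n`!)%N.
Proof.
case: n => // n; elim: n => // n IH.
rewrite size_PIT_seqS expnS factS mulnACA leq_mul// mul2n doubleS.
by rewrite ltnS ltnW// ltnW.
Qed.

Let coef n : R := (num_root_rank k n)%:R / n`!%:R.

Let coef_bound n : 0 <= coef n <= 1 * 2 ^+ n.
Proof.
rewrite divr_ge0//= mul1r ler_pdivrMr ?ltr0n ?fact_gt0// -natrX -natrM ler_nat.
by rewrite num_root_rankE (leq_trans (count_size _ _))// size_PIT_seq_le.
Qed.

(** The factorials cancel, and the first n odd factors in the denominator of the moment count the
    trees on [n+1]. *)
Let coef_moment n : pseries_diffs coef n * sqrt_moment n =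
  root_mean rank_indicator n / ((2 * n%:R + 1) * (2 * n%:R + 3)).
Proof.
rewrite sqrt_momentE root_mean_rankE size_PIT_seqE /pseries_diffs /coef factS natrM.
rewrite !big_nat_recr//= -natr1.
have := fact_gt0 n; rewrite lt0n -(pnatr_eq0 R) => f0.
have : \prod_(0 <= i < n) (2 * i%:R + 1) != 0 :> R.
  by rewrite -size_PIT_seqE pnatr_eq0 -lt0n size_PIT_seq_gt0.
move: (\prod_(0 <= i < n) _) => P P0.
have n0 : 0 <= n%:R :> R by [].
by field; rewrite f0 P0 !gt_eqF//; lra.
Qed.

Lemma rank_constantE : rank_constant R k = 2 * limn (series (fun n =>
  root_mean rank_indicator n / ((2 * n%:R + 1) * (2 * n%:R + 3)))).
Proof.
have mE : (fun n => pseries_diffs coef n * sqrt_moment n) = (fun n =>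
    root_mean rank_indicator n / ((2 * n%:R + 1) * (2 * n%:R + 3))).
  by apply/funext => n; exact: coef_moment.
rewrite /rank_constant; congr (_ * _); rewrite -mE.
apply: (integral_sqrt_weight_pseries coef 1 coef_bound).
by rewrite mE; apply: is_cvg_telescoping_weights; exact: root_mean_rank01.
Qed.

End root_rank.

(** * Asymptotics of the expected number of vertices of rank k *)

Theorem theorem3p4 (R : realType) (k : nat) :
  exists2 eps : nat -> R,
    eps =O_\oo (fun n : nat => n%:R^-1 : R) &
    forall n : nat, (0 < n)%N ->
      PIT_expectation n (fun t => (num_rank k t)%:R) =
      rank_constant R k * n%:R * (1 + eps n).
Proof.
pose p := root_mean (@rank_indicator R k).
pose w n : R := p n / ((2 * n%:R + 1) * (2 * n%:R + 3)).
have p01 : forall j, 0 <= p j <= 1 by exact: root_mean_rank01.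
pose S := limn (series w).
have S0 : 0 < S.
  exact: (telescoping_weights_gt0 p p01 k (root_mean_rank_gt0 k)).
pose e n : R := PIT_expectation n (fun t => (num_rank k t)%:R).
have cE : rank_constant R k = 2 * S by rewrite rank_constantE.
have eE n : e n.+1 = p n + (2 * n%:R + 1) * series w n.
  rewrite /e PIT_expectation_num_rank PIT_vertex_mean//.
  exact: label_blind_rank_indicator.
(* The difference is [p n - S] minus 2n + 1 times the tail of the series; that product lies in
   [0, 1/2] and [p n] in [0, 1]. *)
have err n : `|e n.+1 - 2 * S * n.+1%:R| <= 1 + S.
  have /andP[t0 t1] : 0 <= S - series w n <= _ := telescoping_weights_tail p p01 n.
  have n1 : 0 < 2 * n%:R + 1 :> R by rewrite ltr_wpDl// mulr_ge0.
  have t2 : (2 * n%:R + 1) * (S - series w n) <= 2^-1.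
    by rewrite mulrC -ler_pdivlMr.
  have t3 : 0 <= (2 * n%:R + 1) * (S - series w n) by rewrite mulr_ge0// ltW.
  have -> : e n.+1 - 2 * S * n.+1%:R = p n - S - (2 * n%:R + 1) * (S - series w n).
    by rewrite eE -natr1; ring.
  have /andP[p0 p1] := p01 n.
  by rewrite ler_norml; apply/andP; split; lra.
have cn0 n : 2 * S * n.+1%:R != 0 by rewrite mulf_neq0// mulf_neq0// gt_eqF.
(* The claimed identity is solved for [eps]; dividing the bound 1 + S by 2 S n gives the constant of
   the O-term. *)
exists (fun n => e n / (2 * S * n%:R) - 1); last first.
  by move=> [//|n] _; rewrite cE addrC subrK mulrC divfK.
apply/eqOP/bigO_exP; exists ((1 + S) / (2 * S)).
  by rewrite divr_gt0// ?mulr_gt0// addr_gt0.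
exists 1%N => // -[//|n] _ /=.
rewrite -[X in _ - X](divff (cn0 n)) -mulrBl normrM [X in _ * X]ger0_norm; last first.
  by rewrite invr_ge0 !mulr_ge0// ltW.
rewrite [X in _ <= _ * X]ger0_norm ?invr_ge0// -[X in _ <= X]mulrA -invfM.
by apply: ler_wpM2r (err n); rewrite invr_ge0 !mulr_ge0// ltW.
Qed.
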